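(* Let $1\le p<n$ be integers, $C=[I_p\ \ 0]\in\mathbf{R}^{p\times n}$, $A\in\mathbf{R}^{n\times n}$, $x_0\in\mathbf{R}^n$. Consider the discrete-time linear system $$\Sigma^d:\quad x(k+1)=Ax(k),\quad x(0)=x_0,\qquad y(k)=Cx(k).$$ Suppose that there are (known) vectors $\underline{x}_0,\overline{x}_0\in\mathbf{R}^n$ and matrices $\underline{A},\overline{A}\in\mathbf{R}^{n\times n}$ such that $0\le\underline{x}_0\le x_0\le\overline{x}_0$, $\underline{A}\le A\le\overline{A}$ and $\underline{A}\ge 0$, and suppose that the state trajectory $x(k)$ of $\Sigma^d$ is bounded. Let $\omega_0^\ell,\omega_0^u\in\mathbf{R}^{n-p}$ with $\omega_0^\ell\ge 0$, $\omega_0^u\ge 0$. Let $L\in\mathbf{R}_+^{(n-p)\times p}$ be a nonnegative matrix and, with the block partitions given in the context, put $$\underline{\hat A}:=\underline{A}^{22}-L\overline{A}^{12},\quad \overline{\hat A}:=\overline{A}^{22}-L\underline{A}^{12},$$ $$\underline{G}:=\underline{\hat A}L+\underline{A}^{21}-L\overline{A}^{11},\quad \overline{G}:=\overline{\hat A}L+\overline{A}^{21}-L\underline{A}^{11},$$ $$\hat C:=\begin{bmatrix}0\\ I_{n-p}\end{bmatrix},\quad \hat D:=\begin{bmatrix}I_p\\ L\end{bmatrix}.$$ Suppose that $L$ satisfies: (i) $\underline{\hat A}\ge 0$; (ii) $\underline{G}\ge 0$; (iii) $\overline{\hat A}$ is Schur; (iv) $\omega_0^\ell\le\underline{x}_0^2-L\overline{x}_0^1$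 and $\overline{x}_0^2-L\underline{x}_0^1\le\omega_0^u$. Then $\omega_0^\ell\le\omega_0^u$, and the pair of $(n-p)$-dimensional systems $$\hat\Sigma^{dr\ell}:\quad \omega^\ell(k+1)=\underline{\hat A}\omega^\ell(k)+\underline{G}y(k),\ \ \omega^\ell(0)=\omega_0^\ell,\qquad \hat x^\ell(k):=\hat C\omega^\ell(k)+\hat Dy(k),$$ $$\hat\Sigma^{dru}:\quad \omega^u(k+1)=\overline{\hat A}\omega^u(k)+\overline{G}y(k),\ \ \omega^u(0)=\omega_0^u,\qquad \hat x^u(k):=\hat C\omega^u(k)+\hat Dy(k)$$ is an interval reduced-order positive observer for $\Sigma^d$, in the sense that $\xi(k):=\hat x^u(k)-\hat x^\ell(k)$ is bounded and $$0\le\hat x^\ell(k)\le x(k)\le\hat x^u(k)\quad\text{for all } k=0,1,2,\dots.$$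
   Context: All inequalities between vectors or matrices are elementwise: $M\ge N$ means $m_{ij}\ge n_{ij}$ for all $i,j$. $\mathbf{R}_+^{r\times s}$ is the set of $r\times s$ matrices with nonnegative entries. A square real matrix is Schur if all its eigenvalues lie in the open unit disc of $\mathbf{C}$. Partitions: vectors in $\mathbf{R}^n$ are split as $\underline{x}_0=\begin{bmatrix}\underline{x}_0^1\\ \underline{x}_0^2\end{bmatrix}$, $\overline{x}_0=\begin{bmatrix}\overline{x}_0^1\\ \overline{x}_0^2\end{bmatrix}$ with $\underline{x}_0^1,\overline{x}_0^1\in\mathbf{R}^p$ and $\underline{x}_0^2,\overline{x}_0^2\in\mathbf{R}^{n-p}$; matrices are split conformally as $\underline{A}=\begin{bmatrix}\underline{A}^{11}&\underline{A}^{12}\\ \underline{A}^{21}&\underline{A}^{22}\end{bmatrix}$, $\overline{A}=\begin{bmatrix}\overline{A}^{11}&\overline{A}^{12}\\ \overline{A}^{21}&\overline{A}^{22}\end{bmatrix}$ with $\underline{A}^{11},\overline{A}^{11}\in\mathbf{R}^{p\times p}$. *)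

(* Defs.v *)
(* MathComp / MathComp-Analysis. *)
From HB Require Import structures.
From mathcomp Require Import all_boot all_order all_algebra.
From mathcomp Require Import all_classical all_reals all_analysis.
From mathcomp Require Import complex.
Import Order.TTheory GRing.Theory Num.Theory.
Import numFieldNormedType.Exports.

Set Implicit Arguments.
Unset Strict Implicit.
Unset Printing Implicit Defensive.

Local Open Scope ring_scope.

Definition lemx (R : realType) (r s : nat) (M N : 'M[R]_(r, s)) : Prop :=
  forall i j, M i j <= N i j.

Notation "M <=m N" := (lemx M N) (at level 70, no associativity) : ring_scope.

(* The eigenvalues are complex: the real matrix is first embedded into R[i],
   whose norm is the modulus. *)
Definition schur (R : realType) (m : nat) (M : 'M[R]_m) : Prop :=
  forall z : R[i], eigenvalue (map_mx (real_complex R) M) z -> `|z| < 1.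

Definition autonomous_trajectory (R : realType) (n : nat) (A : 'M[R]_n)
    (x0 : 'cV[R]_n) (x : nat -> 'cV[R]_n) : Prop :=
  x 0%N = x0 /\ forall k, x k.+1 = A *m x k.

Definition driven_trajectory (R : realType) (m p : nat) (F : 'M[R]_m)
    (G : 'M[R]_(m, p)) (w0 : 'cV[R]_m) (y : nat -> 'cV[R]_p)
    (w : nat -> 'cV[R]_m) : Prop :=
  w 0%N = w0 /\ forall k, w k.+1 = F *m w k + G *m y k.

(* The observer matrices depend on two bounds of A: the lower observer uses
   M := lower bound and N := upper bound, the upper observer the converse. *)
Definition obsA (R : realType) (p q : nat) (L : 'M[R]_(q, p))
    (M N : 'M[R]_(p + q)) : 'M[R]_q :=
  drsubmx M - L *m ursubmx N.

Definition obsG (R : realType) (p q : nat) (L : 'M[R]_(q, p))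
    (M N : 'M[R]_(p + q)) : 'M[R]_(q, p) :=
  obsA L M N *m L + dlsubmx M - L *m ulsubmx N.

Definition outC (R : realType) (p q : nat) : 'M[R]_(p, p + q) :=
  row_mx 1%:M 0.

Definition hatC (R : realType) (p q : nat) : 'M[R]_(p + q, q) :=
  col_mx 0 1%:M.

Definition hatD (R : realType) (p q : nat) (L : 'M[R]_(q, p)) :
    'M[R]_(p + q, p) :=
  col_mx 1%:M L.

(* [bounded_fun] refers to the max norm of the entries. *)
Definition interval_positive_observer (R : realType) (n : nat)
    (x xl xu : nat -> 'cV[R]_n) : Prop :=
  bounded_fun (fun k => xu k - xl k) /\
  forall k, [/\ 0 <=m xl k, xl k <=m x k & x k <=m xu k].

(* Main.v *)
Require Import Defs.
From HB Require Import structures.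
From mathcomp Require Import all_boot all_order all_algebra.
From mathcomp Require Import all_classical all_reals all_analysis.
From mathcomp Require Import complex mxred spectral.
Import Order.TTheory GRing.Theory Num.Theory.
Import numFieldNormedType.Exports.

(* The reduced state z := x2 - L x1 satisfies z(k+1) = F z(k) + G y(k) with
   F := A22 - L A12 and G := F L + A21 - L A11, and F, G depend monotonically on
   A because L >= 0; comparing nonnegative systems gives 0 <= wl <= z <= wu.
   Hence the observation error lies between 0 and wu, and wu is bounded because
   it is a Schur system driven by the bounded output y: after a complex unitary
   triangularization, its coordinates can be bounded one after the other. *)

Local Open Scope ring_scope.

Set Implicit Arguments.
Unset Strict Implicit.

(** * Entrywise order and comparison of nonnegative systems *)

Section NonnegativeComparison.
Context {R : realType}.

Lemma lemx_trans m n (M N P : 'M[R]_(m, n)) : M <=m N -> N <=m P -> M <=m P.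
Proof. by move=> MN NP i j; exact: le_trans (MN i j) (NP i j). Qed.

Lemma lemxD m n (M N P Q : 'M[R]_(m, n)) :
  M <=m N -> P <=m Q -> M + P <=m N + Q.
Proof. by move=> MN PQ i j; rewrite !mxE lerD. Qed.

Lemma lemxB m n (M N P Q : 'M[R]_(m, n)) :
  M <=m N -> P <=m Q -> M - Q <=m N - P.
Proof. by move=> MN PQ i j; rewrite !mxE lerB. Qed.

Lemma lemx_mul2l m n p (L : 'M[R]_(m, n)) (M N : 'M[R]_(n, p)) :
  0 <=m L -> M <=m N -> L *m M <=m L *m N.
Proof.
move=> L0 MN i j; rewrite !mxE ler_sum // => k _.
by apply: ler_wpM2l => //; have := L0 i k; rewrite mxE.
Qed.

Lemma lemx_mul2r m n p (L : 'M[R]_(n, p)) (M N : 'M[R]_(m, n)) :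
  0 <=m L -> M <=m N -> M *m L <=m N *m L.
Proof.
move=> L0 MN i j; rewrite !mxE ler_sum // => k _.
by apply: ler_wpM2r => //; have := L0 k j; rewrite mxE.
Qed.

Lemma lemx_mul m n p (M N : 'M[R]_(m, n)) (P Q : 'M[R]_(n, p)) :
  0 <=m M -> M <=m N -> 0 <=m P -> P <=m Q -> M *m P <=m N *m Q.
Proof.
move=> M0 MN P0 PQ; apply: (@lemx_trans _ _ _ (M *m Q)).
  exact: lemx_mul2l.
by apply: lemx_mul2r => //; exact: lemx_trans PQ.
Qed.

Lemma mulmx_ge0 m n p (M : 'M[R]_(m, n)) (N : 'M[R]_(n, p)) :
  0 <=m M -> 0 <=m N -> 0 <=m M *m N.
Proof. by move=> M0 N0; rewrite -(mulmx0 p M); exact: lemx_mul2l. Qed.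

Lemma lemx_ursub m1 m2 n1 n2 (M N : 'M[R]_(m1 + m2, n1 + n2)) :
  M <=m N -> ursubmx M <=m ursubmx N.
Proof. by move=> MN i j; rewrite !mxE. Qed.

Lemma lemx_drsub m1 m2 n1 n2 (M N : 'M[R]_(m1 + m2, n1 + n2)) :
  M <=m N -> drsubmx M <=m drsubmx N.
Proof. by move=> MN i j; rewrite !mxE. Qed.

Lemma lemx_ulsub m1 m2 n1 n2 (M N : 'M[R]_(m1 + m2, n1 + n2)) :
  M <=m N -> ulsubmx M <=m ulsubmx N.
Proof. by move=> MN i j; rewrite !mxE. Qed.

Lemma lemx_dlsub m1 m2 n1 n2 (M N : 'M[R]_(m1 + m2, n1 + n2)) :
  M <=m N -> dlsubmx M <=m dlsubmx N.
Proof. by move=> MN i j; rewrite !mxE. Qed.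

Lemma lemx_usub m1 m2 n (M N : 'M[R]_(m1 + m2, n)) :
  M <=m N -> usubmx M <=m usubmx N.
Proof. by move=> MN i j; rewrite !mxE. Qed.

Lemma lemx_dsub m1 m2 n (M N : 'M[R]_(m1 + m2, n)) :
  M <=m N -> dsubmx M <=m dsubmx N.
Proof. by move=> MN i j; rewrite !mxE. Qed.

Lemma lemx_col_mx m1 m2 n (M1 N1 : 'M[R]_(m1, n)) (M2 N2 : 'M[R]_(m2, n)) :
  M1 <=m N1 -> M2 <=m N2 -> col_mx M1 M2 <=m col_mx N1 N2.
Proof. by move=> MN1 MN2 i j; rewrite !mxE; case: (fintype.split i) => l. Qed.

(** The second bound enters through [- L *m _] with [L] nonnegative, so enlarging it lowers the
    result. *)
Lemma obsA_mono p q (L : 'M[R]_(q, p)) (M M' N N' : 'M[R]_(p + q)) :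
  0 <=m L -> M <=m M' -> N' <=m N -> obsA L M N <=m obsA L M' N'.
Proof.
by move=> L0 MM NN; apply: lemxB; [exact: lemx_drsub |
  apply: lemx_mul2l => //; exact: lemx_ursub].
Qed.

Lemma obsG_mono p q (L : 'M[R]_(q, p)) (M M' N N' : 'M[R]_(p + q)) :
  0 <=m L -> M <=m M' -> N' <=m N -> obsG L M N <=m obsG L M' N'.
Proof.
move=> L0 MM NN; apply: lemxB.
  apply: lemxD; last exact: lemx_dlsub.
  by apply: lemx_mul2r => //; exact: obsA_mono.
by apply: lemx_mul2l => //; exact: lemx_ulsub.
Qed.

Lemma autonomous_ge0 n (A : 'M[R]_n) x0 x : autonomous_trajectory A x0 x ->
  0 <=m A -> 0 <=m x0 -> forall k, 0 <=m x k.
Proof.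
move=> [x_0 xS] A0 x00; elim=> [|k IH]; first by rewrite x_0.
by rewrite xS; exact: mulmx_ge0.
Qed.

(** Sign and order go through one induction: comparing [F *m w k] with [F' *m w' k] uses [0 <=m w k]
    as well as [w k <=m w' k]. *)
Lemma driven_comparison m p (F F' : 'M[R]_m) (G G' : 'M[R]_(m, p)) w0 w0' y
    (w w' : nat -> 'cV[R]_m) :
  driven_trajectory F G w0 y w -> driven_trajectory F' G' w0' y w' ->
  0 <=m F -> F <=m F' -> 0 <=m G -> G <=m G' -> (forall k, 0 <=m y k) ->
  0 <=m w0 -> w0 <=m w0' -> forall k, 0 <=m w k /\ w k <=m w' k.
Proof.
move=> [w_0 wS] [w'_0 w'S] F0 FF G0 GG y0 w00 ww; elim=> [|k [IH0 IH]].
  by rewrite w_0 w'_0.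
rewrite wS w'S; split.
  by rewrite -(addr0 0); apply: lemxD; exact: mulmx_ge0.
apply: lemxD; first exact: lemx_mul.
exact: lemx_mul2r.
Qed.

Lemma outC_usubmx p q n (x : 'M[R]_(p + q, n)) : outC R p q *m x = usubmx x.
Proof.
by rewrite -[x in LHS]vsubmxK /outC mul_row_col mul1mx mul0mx addr0.
Qed.

Lemma hat_col_mx p q (L : 'M[R]_(q, p)) (w : 'cV[R]_q) (y : 'cV[R]_p) :
  hatC R p q *m w + hatD L *m y = col_mx y (w + L *m y).
Proof.
by rewrite /hatC /hatD !mul_col_mx !mul1mx mul0mx add_col_mx add0r.
Qed.

Lemma reduced_trajectory p q (A : 'M[R]_(p + q)) (x0 : 'cV[R]_(p + q))
    (L : 'M[R]_(q, p)) (x : nat -> 'cV[R]_(p + q)) :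
  autonomous_trajectory A x0 x ->
  driven_trajectory (obsA L A A) (obsG L A A) (dsubmx x0 - L *m usubmx x0)
    (fun k => usubmx (x k)) (fun k => dsubmx (x k) - L *m usubmx (x k)).
Proof.
move=> [x_0 xS]; split=> [|k]; first by rewrite x_0.
rewrite xS.
have -> : A *m x k =
    col_mx (ulsubmx A *m usubmx (x k) + ursubmx A *m dsubmx (x k))
           (dlsubmx A *m usubmx (x k) + drsubmx A *m dsubmx (x k)).
  by rewrite -mul_block_col submxK vsubmxK.
rewrite col_mxKd col_mxKu /obsG.
have : drsubmx A - L *m ursubmx A = obsA L A A by [].
(* [F] stays opaque until the terms [F *m (L *m usubmx (x k))] cancel, and is expanded only then. *)
move: (obsA L A A) => F FE.
rewrite [in RHS]mulmxBl mulmxDl -mulmxA [in RHS]mulmxBr -!addrA addKr -FE.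
by rewrite mulmxBl mulmxDr -!mulmxA opprD addrA addrACA addrC.
Qed.

End NonnegativeComparison.

(** * Boundedness of scalar and matrix sequences, real or complex *)

Definition bounded_seq {K : numDomainType} (a : nat -> K) : Prop :=
  exists B, forall k, `|a k| <= B.

Definition entry_bounded {K : numDomainType} {m n : nat}
    (u : nat -> 'M[K]_(m, n)) : Prop :=
  forall i j, bounded_seq (fun k => u k i j).

Section Boundedness.

Lemma bounded_seqD (K : numDomainType) (a b : nat -> K) :
  bounded_seq a -> bounded_seq b -> bounded_seq (fun k => a k + b k).
Proof.
move=> [B aB] [C bC]; exists (B + C) => k.
by rewrite (le_trans (ler_normD _ _)) ?lerD.
Qed.

Lemma bounded_seqZ (K : numDomainType) c (a : nat -> K) :
  bounded_seq a -> bounded_seq (fun k => c * a k).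
Proof. by move=> [B aB]; exists (`|c| * B) => k; rewrite normrM ler_wpM2l. Qed.

Lemma bounded_seq_sum (K : numDomainType) (I : Type) (r : seq I) (P : pred I)
    (a : I -> nat -> K) : (forall i, P i -> bounded_seq (a i)) ->
  bounded_seq (fun k => \sum_(i <- r | P i) a i k).
Proof.
move=> aB; elim: r => [|i r IH].
  by exists 0 => k; rewrite big_nil normr0.
case: (boolP (P i)) => Pi; last first.
  by case: IH => B IH; exists B => k; rewrite big_cons (negPf Pi).
have [B IH'] := bounded_seqD (aB i Pi) IH.
by exists B => k; rewrite big_cons Pi.
Qed.

Lemma entry_boundedD (K : numDomainType) m n (u v : nat -> 'M[K]_(m, n)) :
  entry_bounded u -> entry_bounded v -> entry_bounded (fun k => u k + v k).
Proof.
move=> uB vB i j; have [B uvB] := bounded_seqD (uB i j) (vB i j).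
by exists B => k; rewrite mxE.
Qed.

Lemma entry_boundedMl (K : numDomainType) m n p (M : 'M[K]_(m, n))
    (u : nat -> 'M[K]_(n, p)) :
  entry_bounded u -> entry_bounded (fun k => M *m u k).
Proof.
move=> uB i j.
have [B MB] := bounded_seq_sum (index_enum 'I_n) (P := xpredT)
  (a := fun l k => M i l * u k l j) (fun l _ => bounded_seqZ (M i l) (uB l j)).
by exists B => k; rewrite mxE.
Qed.

Lemma bounded_fun_entry_bounded (R : realType) m n (u : nat -> 'M[R]_(m, n)) :
  bounded_fun u <-> entry_bounded u.
Proof.
split=> [[M [_ uM]] i j|].
  (* [bounded_fun] supplies every number strictly above [M] as a bound, hence [M + 1]. *)
  exists (M + 1) => k.
  apply: le_trans (uM (M + 1) _ k I); last by rewrite ltrDl.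
  rewrite [leRHS]/Num.norm /= mx_normrE.
  by apply/bigmax_geP; right => /=; exists (i, j).
move=> uB.
have /fin_all_exists[B {}uB] : forall ij : 'I_m * 'I_n,
    exists B, forall k, `|u k ij.1 ij.2| <= B by move=> [i j]; exact: uB.
(* The sum dominates each of the finitely many entry bounds; absolute values keep the other summands
   nonnegative. *)
exists (\sum_ij `|B ij|); split=> [|M BM k _]; first exact: num_real.
apply: le_trans (ltW BM); rewrite [leLHS]/Num.norm /= mx_normrE.
apply/bigmax_leP; split=> [|ij _]; first exact: sumr_ge0.
rewrite (le_trans (uB ij k)) // (le_trans (ler_norm _)) //.
by rewrite (bigD1 ij) //= lerDl sumr_ge0.
Qed.

Lemma norm_real_complex (R : rcfType) (a : R) :
  `|real_complex R a| = real_complex R `|a|.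
Proof. by rewrite normc_def /= expr0n addr0 sqrtr_sqr. Qed.

Lemma entry_bounded_complex (R : realType) m n (u : nat -> 'M[R]_(m, n)) :
  entry_bounded (fun k => map_mx (real_complex R) (u k)) <-> entry_bounded u.
Proof.
split=> uB i j; have [B {}uB] := uB i j.
  (* The order of [R[i]] compares only numbers with equal imaginary parts, so [B] is real and its
     real part serves. *)
  exists (complex.Re B) => k; have := uB k.
  by rewrite mxE norm_real_complex lecE => /andP[].
by exists (real_complex R B) => k; rewrite mxE norm_real_complex lecR.
Qed.

End Boundedness.

(** * Schur systems under bounded input *)

Section SchurStability.

Lemma scalar_recurrence_bounded (K : numFieldType) (r : K) (a b : nat -> K) :
  `|r| < 1 -> bounded_seq b -> (forall k, a k.+1 = r * a k + b k) ->
  bounded_seq a.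
Proof.
move=> r1 [B bB] aS; have r1' : 0 < 1 - `|r| by rewrite subr_gt0.
have B0 : 0 <= B by exact: le_trans (bB 0%N).
(* [B / (1 - |r|)] is the fixed point of [t -> |r| t + B]; the term [|a 0|] covers the start and
   does not grow under multiplication by [|r|]. *)
exists (`|a 0%N| + B / (1 - `|r|)); elim=> [|k IH].
  by rewrite lerDl divr_ge0 // ltW.
rewrite aS (le_trans (ler_normD _ _)) // normrM.
rewrite (le_trans (lerD (ler_wpM2l (normr_ge0 r) IH) (bB k))) //.
rewrite mulrDr -addrA lerD //; first by rewrite ler_piMl // ltW.
rewrite -[X in _ + X <= _](divfK (lt0r_neq0 r1')) [_ * (1 - _)]mulrC -mulrDl.
by rewrite addrC subrK mul1r.
Qed.

(* By forward substitution, each coordinate satisfies a scalar recurrence driven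
   by the input and by the coordinates already known to be bounded. *)
Lemma trig_recurrence_bounded (K : numFieldType) m (T : 'M[K]_m)
    (u v : nat -> 'cV[K]_m) :
  is_trig_mx T -> (forall i, `|T i i| < 1) -> entry_bounded v ->
  (forall k, u k.+1 = T *m u k + v k) -> entry_bounded u.
Proof.
move=> /is_trig_mxP trigT diagT vB uS i j.
have [l] := ubnP (nat_of_ord i); elim: l i => // l IH i; rewrite ltnS => il.
apply: (scalar_recurrence_bounded (r := T i i)
  (b := fun k => \sum_(s | s != i) T i s * u k s j + v k i j)) => //;
  last by move=> k; rewrite uS !mxE (bigD1 i) //= addrA.
apply: bounded_seqD; last exact: vB.
apply: bounded_seq_sum => s si; case: (ltngtP s i) => [ls|gs|/val_inj es].
- by apply: bounded_seqZ; apply: IH; exact: leq_trans il.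
(* [is_trig_mx] means lower triangular, so [T i s] vanishes for [s > i]. *)
- by exists 0 => k; rewrite trigT // mul0r normr0.
- by rewrite es eqxx in si.
Qed.

(** The characteristic polynomial of a triangular matrix is the product of the factors
    ['X - T i i]. *)
Lemma trig_eigenvalue (K : fieldType) m (T : 'M[K]_m) i :
  is_trig_mx T -> eigenvalue T (T i i).
Proof.
move=> trigT; rewrite eigenvalue_root_char char_poly_trig //.
by rewrite /root horner_prod (bigD1 i) //= !hornerE subrr mul0r.
Qed.

Lemma schur_driven_bounded (R : realType) m p (F : 'M[R]_m) (G : 'M[R]_(m, p))
    w0 y w :
  schur F -> driven_trajectory F G w0 y w -> entry_bounded y -> entry_bounded w.
Proof.
(* In dimension 0 there are no entries to bound; the triangularization below is applied in positive
   dimension. *)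
case: m F G w0 w => [|m] F G w0 w; first by move=> _ _ _ [].
move=> schurF [_ wS] yB; apply/entry_bounded_complex.
have [P Pu trigP] := Schur (map_mx (real_complex R) F) (ltn0Sn m).
have {}Pu := unitarymx_unit Pu.
set T := conjmx P (map_mx (real_complex R) F) in trigP.
have PF : P *m map_mx (real_complex R) F = T *m P.
  by rewrite /T conjumx // mulmxKV.
(* In the coordinates [P w] the recurrence has the triangular matrix [T] and the bounded input
   [P G y]. *)
have PwB : entry_bounded (fun k => P *m map_mx (real_complex R) (w k)).
  apply: (trig_recurrence_bounded (T := T)
    (v := fun k => P *m map_mx (real_complex R) (G *m y k))) => //.
  (* [T] is similar to the complexified [F], so its diagonal entries are eigenvalues of [F] and lie
     in the open unit disc. *)
  - move=> i; apply/schurF/(eigenvalue_conjmx (V := P)).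
    + by rewrite stablemx_unit.
    + by rewrite row_free_unit.
    + exact: trig_eigenvalue.
  - apply: entry_boundedMl; apply/entry_bounded_complex.
    exact: entry_boundedMl.
  - by move=> k; rewrite wS map_mxD map_mxM mulmxDr !mulmxA PF.
have := entry_boundedMl (invmx P) PwB.
move=> wB i j; have [B {}wB] := wB i j.
by exists B => k; have := wB k; rewrite mulKmx.
Qed.

End SchurStability.

(** * Enclosure and bounded error of the observer pair *)

Unset Implicit Arguments.
Set Strict Implicit.

Theorem corollary2 (R : realType) (p n : nat)
  (p_ge1 : (1 <= p)%N) (p_lt_n : (p < n)%N)
  (A Al Au : 'M[R]_(p + (n - p)))
  (x0 x0l x0u : 'cV[R]_(p + (n - p)))
  (x : nat -> 'cV[R]_(p + (n - p))) (y : nat -> 'cV[R]_p)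
  (x_traj : autonomous_trajectory A x0 x)
  (y_out : forall k, y k = outC R p (n - p) *m x k)
  (x0l_ge0 : 0 <=m x0l) (x0l_le : x0l <=m x0) (x0u_ge : x0 <=m x0u)
  (Al_le : Al <=m A) (Au_ge : A <=m Au) (Al_ge0 : 0 <=m Al)
  (x_bounded : bounded_fun x)
  (w0l w0u : 'cV[R]_(n - p)) (w0l_ge0 : 0 <=m w0l) (w0u_ge0 : 0 <=m w0u)
  (L : 'M[R]_(n - p, p)) (L_ge0 : 0 <=m L)
  (obsAl_ge0 : 0 <=m obsA L Al Au)
  (obsGl_ge0 : 0 <=m obsG L Al Au)
  (obsAu_schur : schur (obsA L Au Al))
  (w0l_le : w0l <=m dsubmx x0l - L *m usubmx x0u)
  (w0u_ge : dsubmx x0u - L *m usubmx x0l <=m w0u)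
  (wl wu : nat -> 'cV[R]_(n - p))
  (wl_traj : driven_trajectory (obsA L Al Au) (obsG L Al Au) w0l y wl)
  (wu_traj : driven_trajectory (obsA L Au Al) (obsG L Au Al) w0u y wu) :
  w0l <=m w0u /\
  interval_positive_observer x
    (fun k => hatC R p (n - p) *m wl k + hatD L *m y k)
    (fun k => hatC R p (n - p) *m wu k + hatD L *m y k).
Proof.
set z := fun k => dsubmx (x k) - L *m usubmx (x k).
have yE k : y k = usubmx (x k) by rewrite y_out outC_usubmx.
have x0_ge0 := lemx_trans x0l_ge0 x0l_le.
have A_ge0 := lemx_trans Al_ge0 Al_le.
(* A nonnegative input makes the order of the input matrices pass to the driven terms in both
   comparisons below. *)
have y_ge0 k : 0 <=m y k.
  rewrite yE -[0](@linear0 _ _ _ _ (@usubmx R p (n - p) 1)).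
  by apply: lemx_usub; exact: autonomous_ge0 x_traj _ _ k.
(* With the true [A] in both slots, [z] obeys a system of the same form as the two observers, with
   the same input. *)
have z_traj : driven_trajectory (obsA L A A) (obsG L A A)
    (dsubmx x0 - L *m usubmx x0) y z.
  by rewrite (_ : y = fun k => usubmx (x k)); [exact: reduced_trajectory |
    exact/funext].
have w0l_z0 : w0l <=m dsubmx x0 - L *m usubmx x0.
  apply: lemx_trans w0l_le _; apply: lemxB; first exact: lemx_dsub.
  by apply: lemx_mul2l => //; exact: lemx_usub.
have z0_w0u : dsubmx x0 - L *m usubmx x0 <=m w0u.
  apply: lemx_trans w0u_ge; apply: lemxB; first exact: lemx_dsub.
  by apply: lemx_mul2l => //; exact: lemx_usub.
have FlF : obsA L Al Au <=m obsA L A A by exact: obsA_mono.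
have FFu : obsA L A A <=m obsA L Au Al by exact: obsA_mono.
have GlG : obsG L Al Au <=m obsG L A A by exact: obsG_mono.
have GGu : obsG L A A <=m obsG L Au Al by exact: obsG_mono.
have wl_z := driven_comparison wl_traj z_traj obsAl_ge0 FlF
  obsGl_ge0 GlG y_ge0 w0l_ge0 w0l_z0.
(* Nonnegativity of the reduced matrices of [A] and of the initial [z] is inherited from the lower
   observer. *)
have z_wu := driven_comparison z_traj wu_traj
  (lemx_trans obsAl_ge0 FlF) FFu
  (lemx_trans obsGl_ge0 GlG) GGu y_ge0
  (lemx_trans w0l_ge0 w0l_z0) z0_w0u.
(* [x] is recovered from [y] and [z] by the formula that yields the estimates from [y] and [wl] or
   [wu], so the enclosure of [z] carries over. *)
have xE k : x k = col_mx (y k) (z k + L *m y k).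
  by rewrite /z yE subrK vsubmxK.
split; first exact: lemx_trans z0_w0u.
split=> [|k]; last first.
  have [wl_ge0 wlz] := wl_z k; have [_ zwu] := z_wu k.
  rewrite !hat_col_mx xE; split.
  - rewrite -col_mx0; apply: lemx_col_mx => //.
    by rewrite -(addr0 0); apply: lemxD => //; exact: mulmx_ge0.
  - by apply: lemx_col_mx => //; exact: lemxD.
  - by apply: lemx_col_mx => //; exact: lemxD.
have yB : entry_bounded y.
  have xB := proj1 (bounded_fun_entry_bounded _) x_bounded.
  by rewrite (funext y_out); exact: entry_boundedMl.
have wuB := schur_driven_bounded obsAu_schur wu_traj yB.
(* Since [0 <= wl <= wu] entrywise, the difference lies between 0 and [wu] and inherits the bound of
   [wu]. *)
have dB : entry_bounded (fun k => wu k - wl k).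
  move=> i j; have [B {}wuB] := wuB i j; exists B => k.
  have [wl_ge0 wlz] := wl_z k; have [_ zwu] := z_wu k.
  have wlwu := le_trans (wlz i j) (zwu i j).
  rewrite !mxE ger0_norm ?subr_ge0 // (le_trans _ (wuB k)) //.
  have := wl_ge0 i j; rewrite mxE => wlij.
  by rewrite (le_trans _ (ler_norm _)) // gerBl.
apply/bounded_fun_entry_bounded.
(* The terms [hatD L *m y k] cancel in the difference of the two estimates. *)
rewrite (_ : (fun k => _) = fun k => hatC R p (n - p) *m (wu k - wl k)).
  exact: entry_boundedMl.
by apply/funext => k; rewrite opprD addrACA subrr addr0 mulmxBr.
Qed.
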